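(* Let $K=\langle S_K\mid R_K\rangle$ be a finitely generated free abelian group, let $n\ge 1$, and let $w_1,\dots,w_n$ be words in $S_K$. Let $G$ be the multiple HNN-extension with base $K$, stable letters $t_1,\dots,t_n$ and associated cyclic subgroups, given by the presentation $$G=\langle S_K,\ t_1,\dots,t_n\mid R_K,\ [t_i,w_i]=1,\ i=1,\dots,n\rangle .$$ Then $G$ is $\mathbb{Z}$-linear.
   Context: A group is called $\mathbb{Z}$-linear (linear over $\mathbb{Z}$) if it admits a faithful representation into $GL_N(\mathbb{Z})$ for some $N$. Here $\langle S_K\mid R_K\rangle$ is a fixed presentation of $K$ with generating set $S_K$ and relators $R_K$. The commutator is $[x,y]=xyx^{-1}y^{-1}$. *)

(* Defs.v *)
From HB Require Import structures.
From mathcomp Require Import all_boot all_algebra.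
From mathcomp Require Import boolp.

Set Implicit Arguments.
Unset Strict Implicit.
Unset Printing Implicit Defensive.

Import GRing.Theory.

(* (x, false) stands for the generator x and (x, true) for its formal inverse *)
Definition letter (S : Type) := (S * bool)%type.
Definition word (S : Type) := seq (letter S).

Section Words.
Variable S : Type.

Definition gen (x : S) : letter S := (x, false).
Definition linv (l : letter S) : letter S := (l.1, ~~ l.2).
Definition winv (u : word S) : word S := rev (map linv u).

(* [u, v] = u v u^-1 v^-1, unlike MathComp's [~ u, v] = u^-1 v^-1 u v *)
Definition wcomm (u v : word S) : word S := u ++ v ++ winv u ++ winv v.

Lemma linvK : involutive linv.
Proof. by case=> x b; rewrite /linv /= negbK. Qed.

Lemma winvK : involutive winv.
Proof. by move=> u; rewrite /winv map_rev revK mapK //; apply: linvK. Qed.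

End Words.

Definition wmap (S S' : Type) (f : S -> S') (u : word S) : word S' :=
  map (fun l => (f l.1, l.2)) u.

(* Equality of words in the group < S | R >: the equivalence relation
   generated by free cancellation and by deletion of relators. *)
Inductive weq (S : Type) (R : word S -> Prop) : word S -> word S -> Prop :=
| weq_refl u : weq R u u
| weq_sym u v : weq R u v -> weq R v u
| weq_trans v u z : weq R u v -> weq R v z -> weq R u z
| weq_cancel u l v : weq R (u ++ l :: linv l :: v) (u ++ v)
| weq_relator u r v : R r -> weq R (u ++ r ++ v) (u ++ v).

Section PresentedGroup.
Variables (S : choiceType) (R : word S -> Prop).

Lemma weq_ctx (a b u v : word S) :
  weq R u v -> weq R (a ++ u ++ b) (a ++ v ++ b).
Proof.
elim=> {u v} [u|u v _|v u z _ IH1 _|u l v|u r v Rr].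
- exact: weq_refl.
- exact: weq_sym.
- exact: weq_trans.
- by have := weq_cancel R (a ++ u) l (v ++ b); rewrite -!catA.
- by have := weq_relator (a ++ u) (v ++ b) Rr; rewrite -!catA.
Qed.

Lemma weq_cat (u u' v v' : word S) :
  weq R u u' -> weq R v v' -> weq R (u ++ v) (u' ++ v').
Proof.
move=> uu' vv'; apply: (@weq_trans _ _ (u' ++ v)).
  exact: (@weq_ctx [::] v).
by have := @weq_ctx u' [::] _ _ vv'; rewrite !cats0.
Qed.

Lemma weq_invr (u : word S) : weq R (u ++ winv u) [::].
Proof.
elim: u => [|l u IH]; first exact: weq_refl.
rewrite /winv /= rev_cons -cats1 -/(winv u).
have := @weq_ctx [:: l] [:: linv l] _ _ IH; rewrite /= -catA => h.
by apply: weq_trans h _; apply: (@weq_cancel _ _ [::] l [::]).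
Qed.

Lemma weq_invl (u : word S) : weq R (winv u ++ u) [::].
Proof. by have := weq_invr (winv u); rewrite winvK. Qed.

Lemma weq_winv (u v : word S) : weq R u v -> weq R (winv u) (winv v).
Proof.
move=> uv; apply: (@weq_trans _ _ (winv u ++ (v ++ winv v))).
  have := weq_cat (weq_refl R (winv u)) (weq_sym (weq_invr v)).
  by rewrite cats0.
rewrite catA; apply: (@weq_trans _ _ ([::] ++ winv v)); last exact: weq_refl.
apply: weq_cat; last exact: weq_refl.
apply: weq_trans (weq_invl u).
by apply: weq_cat; [exact: weq_refl | exact: weq_sym].
Qed.

Definition weqb (u v : word S) : bool := `[< weq R u v >].

Lemma weqb_refl : reflexive weqb.
Proof. by move=> u; apply/asboolP; apply: weq_refl. Qed.

Lemma weqb_sym : symmetric weqb.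
Proof. by move=> u v; apply/asboolP/asboolP; apply: weq_sym. Qed.

Lemma weqb_trans : transitive weqb.
Proof.
by move=> v u z /asboolP uv /asboolP vz; apply/asboolP; apply: weq_trans vz.
Qed.

Canonical weqb_equiv := EquivRel weqb weqb_refl weqb_sym weqb_trans.

Definition presented : Type := {eq_quot weqb_equiv}%qT.

HB.instance Definition _ := Choice.on presented.
HB.instance Definition _ := EqQuotient.on presented.

Definition pclass (u : word S) : presented := \pi_presented%qT u.

Lemma pclassP (u v : word S) : pclass u = pclass v <-> weq R u v.
Proof.
split=> [/eqmodP /asboolP //|uv].
by apply/eqmodP; apply/asboolP.
Qed.

Lemma pclass_repr (x : presented) : pclass (repr x) = x.
Proof. exact: reprK. Qed.

Lemma weq_repr (u : word S) : weq R (repr (pclass u)) u.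
Proof. by apply/pclassP; rewrite pclass_repr. Qed.

Definition pone : presented := pclass [::].
Definition pmul (x y : presented) : presented := pclass (repr x ++ repr y).
Definition pinv (x : presented) : presented := pclass (winv (repr x)).

Lemma pmulE (u v : word S) : pmul (pclass u) (pclass v) = pclass (u ++ v).
Proof. by apply/pclassP; apply: weq_cat; apply: weq_repr. Qed.

Lemma pinvE (u : word S) : pinv (pclass u) = pclass (winv u).
Proof. by apply/pclassP; apply: weq_winv; apply: weq_repr. Qed.

Lemma pmulA : associative pmul.
Proof.
move=> x y z; rewrite -(pclass_repr x) -(pclass_repr y) -(pclass_repr z).
by rewrite !pmulE catA.
Qed.

Lemma pmul1 : left_id pone pmul.
Proof. by move=> x; rewrite -(pclass_repr x) pmulE. Qed.

Lemma pmulr1 : right_id pone pmul.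
Proof. by move=> x; rewrite -(pclass_repr x) pmulE cats0. Qed.

Lemma pmulV : left_inverse pone pinv pmul.
Proof.
move=> x; rewrite -(pclass_repr x) pinvE pmulE.
by apply/pclassP; apply: weq_invl.
Qed.

Lemma pmulrV : right_inverse pone pinv pmul.
Proof.
move=> x; rewrite -(pclass_repr x) pinvE pmulE.
by apply/pclassP; apply: weq_invr.
Qed.

HB.instance Definition _ :=
  isGroup.Build presented pmulA pmul1 pmulr1 pmulV pmulrV.

End PresentedGroup.

Section GeneralLinear.
Variables (R : comUnitRingType) (n : nat).

(* MathComp's {'GL_n[R]} requires R to be finite *)
Record GLmx : Type := MkGLmx { glval :> 'M[R]_n; _ : glval \in unitmx }.

HB.instance Definition _ := [isSub for glval].
HB.instance Definition _ := [Choice of GLmx by <:].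

Definition gl_one : GLmx := MkGLmx (unitmx1 R n).

Fact gl_mul_subproof (A B : GLmx) : (glval A *m glval B)%R \in unitmx.
Proof. by rewrite unitmx_mul (valP A) (valP B). Qed.
Definition gl_mul (A B : GLmx) : GLmx := MkGLmx (gl_mul_subproof A B).

Fact gl_inv_subproof (A : GLmx) : invmx (glval A) \in unitmx.
Proof. by rewrite unitmx_inv (valP A). Qed.
Definition gl_inv (A : GLmx) : GLmx := MkGLmx (gl_inv_subproof A).

Lemma gl_mulA : associative gl_mul.
Proof. by move=> A B C; apply: val_inj; rewrite /= mulmxA. Qed.

Lemma gl_mul1 : left_id gl_one gl_mul.
Proof. by move=> A; apply: val_inj; rewrite /= mul1mx. Qed.

Lemma gl_mulr1 : right_id gl_one gl_mul.
Proof. by move=> A; apply: val_inj; rewrite /= mulmx1. Qed.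

Lemma gl_mulV : left_inverse gl_one gl_inv gl_mul.
Proof. by move=> A; apply: val_inj; rewrite /= mulVmx ?(valP A). Qed.

Lemma gl_mulrV : right_inverse gl_one gl_inv gl_mul.
Proof. by move=> A; apply: val_inj; rewrite /= mulmxV ?(valP A). Qed.

HB.instance Definition _ :=
  isGroup.Build GLmx gl_mulA gl_mul1 gl_mulr1 gl_mulV gl_mulrV.

End GeneralLinear.

Definition Z_linear (G : groupType) : Prop :=
  exists (N : nat) (rho : G -> GLmx int N),
    {morph rho : x y / (x * y)%g} /\ injective rho.

Definition fg_free_abelian (K : groupType) : Prop :=
  exists (r : nat) (f : K -> 'rV[int]_r),
    {morph f : x y / (x * y)%g >-> (x + y)%R} /\ bijective f.

(* Relators of < S, t_1, ..., t_n | R, [t_i, w_i] = 1 >; the generators are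
   the inl x for x in S together with the stable letters t_i = inr i. *)
Inductive hnn_relators (S : Type) (R : word S -> Prop) (n : nat)
    (w : 'I_n -> word S) : word (S + 'I_n) -> Prop :=
| hnn_base r : R r -> hnn_relators R w (wmap inl r)
| hnn_comm i : hnn_relators R w (wcomm [:: gen (inr i)] (wmap inl (w i))).

(* Main.v *)
Require Import Defs.
From mathcomp Require Import all_boot all_order all_algebra.
From mathcomp Require Import boolp.
From mathcomp Require Import zify ring.
From mathcomp.real_closed Require Import mxtens.

Set Implicit Arguments.
Unset Strict Implicit.
Unset Printing Implicit Defensive.

Import Order.TTheory GRing.Theory Num.Theory.

(** Identify K with Z^r and let c_i be the vector of w_i.  The
   K-conjugates of the stable letters freely generate the kernel of the
   retraction G -> K, those of t_i being indexed by the cosets in K / <c_i>, so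
   a faithful representation of G can be found by playing ping-pong with
   infinitely many players, two for each coset.  Reflections achieve
   this, by the argument that makes the geometric representation of a universal
   Coxeter group faithful.

   Suppose K acts on Z^N by matrices A k, and that there are vectors v_j and
   covectors p_j, where j = (i, b) runs over two copies of the indices i, both
   v_j and p_j being fixed by c_i, such that p_j A(k) v_j' is 2 when
   (j, k) and (j', 0) are the same player, i.e. j = j' and k is in <c_j>,
   and at most -2 otherwise.  Let s_j = 1 - v_j p_j, and send t_i to
   s_(i,false) s_(i,true).  This commutes with A(c_i), so G acts.
   The player (j, k) measures u by its height p_j A(-k) u.  If one player has
   positive height a and all others have height at most -a, then reflecting in
   a different player hands the dominating role over to that player
   ([dominates_reflection_next]).  A word with stable letters, in which no t_i and
   t_i^-1 or t_i^-1 and t_i enclose an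
   element of <c_i> never reflects twice in a row in the same player,
   so it cannot fix a K-fixed vector at which every height is negative; and an
   enclosed element of <c_i> can be moved out ([pinch]), which shortens the
   word.
   Extra players indexed by None, with c = 0, make K act faithfully.

   It remains to produce the configuration ([ping_pong_exists]).  One needs, for
   each c in Z^r, a matrix coefficient of a representation of Z^r / <c> on some
   Z^N with value 4 at 0 and values at most 0 outside <c>.  Matrix coefficients
   form a ring containing the additive functions vanishing at c and the
   indicators of kernels of homomorphisms to finite groups vanishing at c.  If
   the entry c_b is nonzero, then
     4 [c_b divides k_b] (1 - sum_a (c_a k_b - c_b k_a)^2)
   is such a function ([coefficient_separating]): the squares detect the line
   Q c, the divisibility detects <c> within it, and both matter because c need
   not be primitive.  In the direct sum of these representations players with
   different j pair to 0, and one more trivial summand subtracts 2 from every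
   pairing. *)

(** * Matrix coefficients of integral representations *)

Section Coefficients.
Local Open Scope ring_scope.
Variable K : zmodType.
Implicit Types (c k : K) (f g : K -> int).

Definition is_repr N (A : K -> 'M[int]_N) : Prop :=
  A 0 = 1%:M /\ forall k l, A (k + l) = A k *m A l.

(** The functions K -> Z arising from representations of K / <c>: asking that
   A c be the identity, and not only that f be c-periodic, makes c fix the
   vector and the covector as well, which is what commutation with the
   reflections requires. *)
Definition coefficient c f : Prop :=
  exists N (A : K -> 'M[int]_N) (p : 'rV_N) (v : 'cV_N),
    [/\ is_repr A, A c = 1%:M & forall k, f k = (p *m A k *m v) 0 0].

Lemma is_repr_block N1 N2 (A1 : K -> 'M[int]_N1) (A2 : K -> 'M[int]_N2) :
  is_repr A1 -> is_repr A2 -> is_repr (fun k => block_mx (A1 k) 0 0 (A2 k)).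
Proof.
move=> [A10 A1D] [A20 A2D]; split=> [|k l]; first by rewrite A10 A20 -scalar_mx_block.
by rewrite A1D A2D mulmx_block !mulmx0 !mul0mx !addr0 !add0r.
Qed.

Lemma block_pairing N1 N2 (A1 : 'M[int]_N1) (A2 : 'M[int]_N2) p1 p2 v1 v2 :
  (row_mx p1 p2 *m block_mx A1 0 0 A2 *m col_mx v1 v2) =
  (p1 *m A1 *m v1) + (p2 *m A2 *m v2) :> 'M_1.
Proof. by rewrite mul_row_block !mulmx0 addr0 add0r mul_row_col. Qed.

Lemma coefficient_ext c f g : f =1 g -> coefficient c f -> coefficient c g.
Proof.
move=> fg [N [A [p [v [Ar Ac fE]]]]]; exists N, A, p, v; split=> // k.
by rewrite -fg.
Qed.

Lemma coefficient_const c a : coefficient c (fun=> a).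
Proof.
exists 1%N, (fun=> 1%:M), a%:M, 1%:M; split=> //.
  by split=> // k l; rewrite mulmx1.
by move=> k; rewrite !mulmx1 mxE.
Qed.

Lemma coefficientD c f g :
  coefficient c f -> coefficient c g -> coefficient c (fun k => f k + g k).
Proof.
move=> [N1 [A1 [p1 [v1 [r1 c1 E1]]]]] [N2 [A2 [p2 [v2 [r2 c2 E2]]]]].
exists (N1 + N2)%N, (fun k => block_mx (A1 k) 0 0 (A2 k)).
exists (row_mx p1 p2), (col_mx v1 v2); split.
- exact: is_repr_block.
- by rewrite c1 c2 -scalar_mx_block.
- by move=> k; rewrite block_pairing mxE E1 E2.
Qed.

(** The tensor product of two representations multiplies their coefficients. *)
Lemma coefficientM c f g :
  coefficient c f -> coefficient c g -> coefficient c (fun k => f k * g k).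
Proof.
move=> [N1 [A1 [p1 [v1 [r1 c1 E1]]]]] [N2 [A2 [p2 [v2 [r2 c2 E2]]]]].
have tens1 : (1%:M : 'M[int]_N1) *t (1%:M : 'M[int]_N2) = 1%:M.
  apply/matrixP=> i j.
  case: (mxtens_indexP i) => i1 i2; case: (mxtens_indexP j) => j1 j2.
  rewrite tensmxE !mxE (can_eq (@mxtens_indexK _ _)) xpair_eqE.
  by rewrite -natrM mulnb.
exists (N1 * N2)%N, (fun k => A1 k *t A2 k), (p1 *t p2), (v1 *t v2); split.
- case: r1 r2 => [A10 A1D] [A20 A2D]; split=> [|k l]; first by rewrite A10 A20.
  by rewrite A1D A2D tensmx_mul.
- by rewrite c1 c2.
(* The index type 'I_(1 * 1) of a tensor product of 1 x 1 matrices is 'I_1. *)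
- move=> k; have -> : 0 = @mxtens_index 1 1 (0, 0) :> 'I_1 by exact: val_inj.
  transitivity (((p1 *t p2) *m (A1 k *t A2 k) *m (v1 *t v2))
    (mxtens_index (0, 0)) (mxtens_index (0, 0))) => //.
  by rewrite !tensmx_mul tensmxE E1 E2.
Qed.

Lemma morph_add0 (V : zmodType) (h : K -> V) :
  {morph h : k l / k + l} -> h 0 = 0.
Proof. by move=> hD; apply: (addrI (h 0)); rewrite -hD !addr0. Qed.

(** The unipotent matrices with h k above the diagonal multiply by adding the
   values of h. *)
Lemma coefficient_additive c (h : K -> int) :
  {morph h : k l / k + l} -> h c = 0 -> coefficient c h.
Proof.
move=> hD hc; exists (1 + 1)%N, (fun k => block_mx 1%:M (h k)%:M 0 1%:M).
exists (row_mx 1%:M 0), (col_mx 0 1%:M); split.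
- split=> [|k l]; first by rewrite (morph_add0 hD) raddf0 -scalar_mx_block.
  by rewrite mulmx_block !mulmx0 !mul0mx !addr0 !add0r !mulmx1 !mul1mx hD raddfD /= addrC.
- by rewrite hc raddf0 -scalar_mx_block.
- by move=> k; rewrite mul_row_block mul_row_col !mul0mx !mulmx0 !addr0 !add0r mul1mx mulmx1 mxE.
Qed.

(** K permutes the finite group Q by translation, and a diagonal entry of the
   permutation matrix of k says whether q k is zero. *)
Lemma coefficient_indicator c (Q : finZmodType) (q : K -> Q) :
  {morph q : k l / k + l} -> q c = 0 -> coefficient c (fun k => (q k == 0)%:R).
Proof.
move=> qD qc.
pose A k : 'M[int]_#|Q| := \matrix_(i, j) (enum_val i == q k + enum_val j)%:R.
have A0 k : q k = 0 -> A k = 1%:M.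
  move=> qk; apply/matrixP=> i j.
  by rewrite !mxE qk add0r (inj_eq enum_val_inj).
exists #|Q|, A, (delta_mx 0 (enum_rank 0)), (delta_mx (enum_rank 0) 0); split.
- split=> [|k l]; first by rewrite A0 ?(morph_add0 qD).
  apply/matrixP=> i j; rewrite !mxE.
  rewrite (bigD1 (enum_rank (q l + enum_val j))) //= !mxE enum_rankK eqxx mulr1.
  rewrite big1 ?addr0 ?qD -?addrA // => m mj; rewrite !mxE.
  case: (enum_val m =P _) => [mE|]; last by rewrite mulr0.
  by rewrite -mE enum_valK eqxx in mj.
- exact: A0.
- by move=> k; rewrite -rowE -colE !mxE !enum_rankK addr0 eq_sym.
Qed.

Lemma coefficient_sum_squares c (I : finType) (h : I -> K -> int) :
  (forall i, {morph h i : k l / k + l}) -> (forall i, h i c = 0) ->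
  coefficient c (fun k => 1 - \sum_i h i k ^+ 2).
Proof.
move=> hD hc; apply: coefficientD; first exact: coefficient_const.
apply: (@coefficient_ext _ (fun k => \sum_(i <- index_enum I) (-1) * (h i k * h i k))).
  by move=> k; rewrite -sumrN; apply: eq_bigr => i _; rewrite mulN1r.
elim: (index_enum I) => [|i s IH].
  by apply: (coefficient_ext _ (coefficient_const c 0)) => k; rewrite big_nil.
have hi := coefficient_additive (hD i) (hc i).
apply: coefficient_ext (coefficientD (coefficientM (coefficient_const c (-1))
  (coefficientM hi hi)) IH) => k.
by rewrite big_cons.
Qed.
End Coefficients.

(** * Separating a cyclic subgroup of Z^r from its complement *)

Section Separation.
Local Open Scope ring_scope.

Definition multiple (K : zmodType) (c k : K) : Prop := exists z, k = c *~ z.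

Lemma sum_squares_le0 (I : finType) (x : I -> int) i :
  x i != 0 -> 1 - \sum_j x j ^+ 2 <= 0.
Proof.
move=> xi; rewrite subr_le0 (bigD1 i) //=.
apply: (@le_trans _ _ (x i ^+ 2)); first by rewrite -gtz0_ge1 exprn_even_gt0.
by rewrite lerDl sumr_ge0 // => j _; apply: sqr_ge0.
Qed.

Lemma inZp1_mulrz_eq0 m (z : int) :
  ((inZp 1 : 'I_m.+1) *~ z == 0) = (m.+1 %| `|z|)%N.
Proof.
have natE n : ((inZp 1 : 'I_m.+1) *+ n == 0) = (m.+1 %| n)%N.
  by rewrite Zp_mulrn -val_eqE /= modnMml mul1n.
by case: z => n; rewrite ?NegzE ?mulrNz ?oppr_eq0 ?abszN -pmulrn natE.
Qed.

(** The value 4 at 0 becomes the pairing 2 of a player with itself once the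
   constant 2 is subtracted, and the values at most 0 become at most -2. *)
Lemma coefficient_separating r (c : 'rV[int]_r) :
  exists f, [/\ coefficient c f, f 0 = 4 & forall k, multiple c k \/ f k <= 0].
Proof.
have [->|c0] := eqVneq c 0.
  exists (fun k : 'rV_r => 4 * (1 - \sum_i k 0 i ^+ 2)); split.
  - apply: coefficientM; first exact: coefficient_const.
    by apply: coefficient_sum_squares => [i k l|i]; rewrite mxE.
  - by rewrite big1 // => i _; rewrite mxE expr0n.
  - move=> k; have [k0|] := eqVneq k 0; first by left; exists 0; rewrite mulr0z.
    by case/rV0Pn=> i ki; right; rewrite pmulr_rle0 // (sum_squares_le0 ki).
have /rV0Pn [b cb] := c0.
have [m dE] : exists m, absz (c 0 b) = m.+1 by exists (absz (c 0 b)).-1; rewrite prednK // absz_gt0.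
(* h vanishes exactly on the rational line through c; q detects, on this line,
   the integral multiples of c. *)
pose q (k : 'rV[int]_r) : 'I_m.+1 := inZp 1 *~ k 0 b.
pose h a (k : 'rV[int]_r) := c 0 a * k 0 b - c 0 b * k 0 a.
exists (fun k => 4 * ((q k == 0)%:R * (1 - \sum_a h a k ^+ 2))); split.
- apply: coefficientM; first exact: coefficient_const.
  apply: coefficientM.
    apply: coefficient_indicator => [k l|]; first by rewrite /q mxE mulrzDr.
    by apply/eqP; rewrite inZp1_mulrz_eq0 dE.
  apply: coefficient_sum_squares => [a k l|a]; rewrite /h ?mxE; ring.
- rewrite /q mxE mulr0z eqxx big1 // => a _; by rewrite /h !mxE !mulr0 subrr expr0n.
- move=> k; have [q0|] := boolP (q k == 0); last by right; rewrite mul0r mulr0.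
  have /dvdzP [z kbE] : (c 0%R b %| k 0%R b)%Z.
    by move: q0; rewrite inZp1_mulrz_eq0 -dE.
  have [/forallP ha|] := boolP [forall a, h a k == 0].
    left; exists z; apply/rowP=> a; rewrite -scaler_int mxE intz.
    by apply: (mulfI cb); move: (ha a); rewrite /h subr_eq0 kbE => /eqP <-; ring.
  rewrite negb_forall => /existsP [a ha]; right.
  by rewrite mul1r pmulr_rle0 // (sum_squares_le0 ha).
Qed.
End Separation.

(** * Configurations of reflections *)

Section PingPong.
Local Open Scope ring_scope.

(** In the direct sum of the representations behind the f_i, vectors and
   covectors from different summands pair to 0.  Building the sum one index at
   a time avoids block matrices of dependent sizes. *)
Lemma orthogonal_coefficients (K : zmodType) (J : finType) (c : J -> K)
    (f : J -> K -> int) :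
  (forall i, coefficient (c i) (f i)) ->
  exists N (A : K -> 'M[int]_N) (p : J -> 'rV_N) (v : J -> 'cV_N),
    [/\ is_repr A, forall i, p i *m A (c i) = p i,
        forall i, A (c i) *m v i = v i
      & forall i j k, (p i *m A k *m v j) 0 0 = if i == j then f i k else 0].
Proof.
move=> fc.
suff [N [A [p [v [Ar pc vc E]]]]] : exists N (A : K -> 'M[int]_N) (p : J -> 'rV_N) (v : J -> 'cV_N),
    [/\ is_repr A, {in enum J, forall i, p i *m A (c i) = p i},
        {in enum J, forall i, A (c i) *m v i = v i}
      & {in enum J &, forall i j k, (p i *m A k *m v j) 0 0 = if i == j then f i k else 0}].
  by exists N, A, p, v; split=> // [i|i|i j k]; rewrite ?pc ?vc ?E ?mem_enum.
elim: (enum J) => [|x s [N [A [p [v [Ar pc vc E]]]]]].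
  exists 0%N, (fun=> 1%:M), (fun=> 0), (fun=> 0); split=> //.
  by split=> // k l; rewrite mulmx1.
have [M [B [q [z [Br Bc Ex]]]]] := fc x.
exists (M + N)%N, (fun k => block_mx (B k) 0 0 (A k)).
exists (fun i => if i == x then row_mx q 0 else row_mx 0 (p i)).
exists (fun i => if i == x then col_mx z 0 else col_mx 0 (v i)).
split.
- exact: is_repr_block.
- move=> i; rewrite inE; case: eqVneq => [-> _|_ /= si].
    by rewrite mul_row_block !mulmx0 !mul0mx !addr0 Bc mulmx1.
  by rewrite mul_row_block !mulmx0 !mul0mx !add0r pc.
- move=> i; rewrite inE; case: eqVneq => [-> _|_ /= si].
    by rewrite mul_block_col !mulmx0 !mul0mx !addr0 Bc mul1mx.
  by rewrite mul_block_col !mulmx0 !mul0mx !add0r vc.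
- move=> i j; rewrite !inE => si sj k.
  move: si sj; case: (eqVneq i x) => [->|ix] /= si; case: (eqVneq j x) => [->|jx] /= sj;
    rewrite block_pairing ?mulmx0 ?mul0mx ?addr0 ?add0r.
  + by rewrite Ex.
  + by rewrite mxE.
  + by rewrite (negPf ix) mxE.
  + exact: E.
Qed.

(** The players are the pairs (j, k), with (j, k) and (j, l) identified when
   k - l is a multiple of c j; the conditions say that they behave like the
   simple roots of a universal Coxeter group permuted by K.  The vector o is a
   starting point that no player dominates. *)
Definition ping_pong (K : zmodType) (J : Type) (c : J -> K) N
    (A : K -> 'M[int]_N) (p : J -> 'rV[int]_N) (v : J -> 'cV[int]_N)
    (o : 'cV[int]_N) : Prop :=
  [/\ is_repr A,
      forall j, p j *m A (c j) = p j /\ A (c j) *m v j = v j,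
      forall j, (p j *m v j) 0 0 = 2,
      forall i j k, ~ (i = j /\ multiple (c i) k) -> (p i *m A k *m v j) 0 0 <= - 2
    & forall k, A k *m o = o /\ forall j, (p j *m o) 0 0 < 0].

(** The extra trivial summand pairs every two players to -2, whatever their
   cosets, and its basis vector is the common starting point. *)
Lemma ping_pong_exists r (J : finType) (c : J -> 'rV[int]_r) :
  exists N (A : 'rV[int]_r -> 'M[int]_N) p v o, ping_pong c A p v o.
Proof.
have [f fP] := boolp.choice (fun j => coefficient_separating (c j)).
have fc j : coefficient (c j) (f j) by case: (fP j).
have [N [A [p [v [Ar pc vc E]]]]] := orthogonal_coefficients fc.
have r1 : is_repr (fun _ : 'rV[int]_r => 1%:M : 'M[int]_1).
  by split=> // k l; rewrite mulmx1.
have [A0 _] := Ar.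
exists (N + 1)%N, (fun k => block_mx (A k) 0 0 1%:M).
exists (fun j => row_mx (p j) (- 2)%:M), (fun j => col_mx (v j) 1%:M), (col_mx 0 1%:M).
have pairE i j k :
    (row_mx (p i) (- 2)%:M *m block_mx (A k) 0 0 1%:M *m col_mx (v j) 1%:M) 0 0 =
    (if i == j then f i k else 0) - 2.
  by rewrite block_pairing !mulmx1 mxE E mxE.
split.
- exact: is_repr_block.
- move=> j; rewrite mul_row_block mul_block_col.
  by rewrite !mulmx0 !mul0mx !mulmx1 !addr0 !add0r pc vc.
- move=> j; have := pairE j j 0.
  rewrite A0 -scalar_mx_block mulmx1 eqxx => ->.
  by case: (fP j) => _ ->.
- move=> i j k nij; rewrite pairE; case: eqP => [ij|]; last by lia.
  by case: (fP i) => _ _ /(_ k) [ck|]; [case: nij | lia].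
- move=> k; split=> [|j]; first by rewrite mul_block_col !mulmx0 !mul0mx addr0 add0r mulmx1.
  by rewrite mul_row_col mulmx0 add0r mulmx1 mxE.
Qed.

Lemma multipleN (K : zmodType) (c k : K) : multiple c (- k) -> multiple c k.
Proof. by case=> z kE; exists (- z); rewrite mulrNz -kE opprK. Qed.

(** * Ping-pong *)

Section Dynamics.
Variables (K : zmodType) (J : Type) (c : J -> K) (N : nat).
Variables (A : K -> 'M[int]_N) (p : J -> 'rV[int]_N) (v : J -> 'cV[int]_N).
Variable o : 'cV[int]_N.
Hypothesis pp : ping_pong c A p v o.

Let A0 : A 0 = 1%:M. Proof. by case: pp => [[]]. Qed.
Let AD k l : A (k + l) = A k *m A l. Proof. by case: pp => [[]]. Qed.

Definition reflection j : 'M[int]_N := 1%:M - v j *m p j.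

Lemma reflectionK j : reflection j *m reflection j = 1%:M.
Proof.
case: pp => _ _ /(_ j) p2 _ _.
have vpvp : v j *m p j *m (v j *m p j) = 2%:R *: (v j *m p j).
  rewrite -mulmxA [p j *m _]mulmxA [p j *m v j]mx11_scalar p2.
  by rewrite mul_scalar_mx -scalemxAr.
rewrite mulmxBl !mulmxBr ?mulmx1 !mul1mx vpvp.
by rewrite scaler_nat mulr2n; set x := v j *m p j; rewrite opprB addrK subrK.
Qed.

Lemma reflection_comm j : A (c j) *m reflection j = reflection j *m A (c j).
Proof.
case: pp => _ /(_ j) [pA Av] _ _ _.
by rewrite /reflection mulmxBr mulmxBl mulmx1 mul1mx mulmxA Av -mulmxA pA.
Qed.

(** The covector of the player (j, k) is the translate of p j by k, whence the
   sign. *)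
Definition height j k (u : 'cV[int]_N) : int := (p j *m A (- k) *m u) 0 0.

Definition dominates j0 k0 u : Prop :=
  0 < height j0 k0 u /\
  forall j k, ~ (j = j0 /\ multiple (c j) (k - k0)) ->
    height j k u <= - height j0 k0 u.

Lemma height_shift j k l u : height j k (A l *m u) = height j (k - l) u.
Proof. by rewrite /height mulmxA -[in LHS](mulmxA (p j)) -AD opprB addrC. Qed.

Let cov_fixed j z : p j *m A (c j *~ z) = p j.
Proof.
case: pp => _ /(_ j) [pA _] _ _ _.
have pAn n : p j *m A (c j *+ n) = p j.
  by elim: n => [|n IH]; rewrite ?mulr0n ?A0 ?mulmx1 // mulrS AD mulmxA pA.
case: z => n; first exact: pAn.
by rewrite NegzE mulrNz -pmulrn -[in LHS](pAn n.+1) -mulmxA -AD subrr A0 mulmx1.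
Qed.

(** A height depends only on the player, that is, on the coset of k. *)
Lemma height_coset j k l u :
  multiple (c j) (k - l) -> height j k u = height j l u.
Proof.
case=> z kl; rewrite -[k](subrK l) kl /height opprD AD mulmxA -mulrNz.
by rewrite cov_fixed.
Qed.

Lemma dominates_shift j0 k0 l u :
  dominates j0 k0 u -> dominates j0 (k0 + l) (A l *m u).
Proof.
case=> pos neg; split=> [|j k njk]; first by rewrite height_shift addrK.
by rewrite !height_shift addrK; apply: neg; rewrite -addrA -opprD (addrC l).
Qed.

(** Reflecting u in the player (j, 0), of height -b < 0, adds b times its vector.
   This turns the height of that player into b and lowers each other height,
   which was at most b, by at least 2b. *)
Lemma dominates_reflection j u :
  0 < - height j 0 u ->
  (forall i k, ~ (i = j /\ multiple (c i) k) -> height i k u <= - height j 0 u) ->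
  dominates j 0 (reflection j *m u).
Proof.
case: pp => _ _ p2 le2 _ pos neg.
have heightE i k : height i k (reflection j *m u) =
    height i k u - height j 0 u * (p i *m A (- k) *m v j) 0 0.
  have mxB (x y : 'M[int]_1) : (x - y) 0 0 = x 0 0 - y 0 0 by rewrite !mxE.
  rewrite /height /reflection mulmxBl mul1mx mulmxBr mxB oppr0 A0 mulmx1.
  congr (_ - _); rewrite -(mulmxA (v j)) [p j *m u]mx11_scalar mul_mx_scalar.
  by rewrite -scalemxAr !mxE.
have hj : height j 0 (reflection j *m u) = - height j 0 u.
  by rewrite heightE oppr0 A0 mulmx1 p2; lia.
split=> [|i k]; rewrite hj // subr0 => nik.
have nik' : ~ (i = j /\ multiple (c i) (- k)) by case=> ij /multipleN ik; case: nik.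
rewrite heightE; move: (neg i k nik) (le2 i j _ nik') pos.
set x := height i k u; set a := height j 0 u; set q := fun_of_matrix _ _ _ => h1 h2 h3.
by nia.
Qed.

(** The bound that a dominating player imposes on the heights of the others is
   what any other player needs in order to take over. *)
Lemma dominates_reflection_next j0 k0 j u :
  dominates j0 k0 u -> ~ (j = j0 /\ multiple (c j) k0) ->
  dominates j 0 (reflection j *m u).
Proof.
case=> pos neg nj.
have lej : height j 0 u <= - height j0 k0 u.
  by apply: neg; rewrite sub0r => -[jj0 /multipleN jk0]; apply: nj.
apply: dominates_reflection => [|i k nik]; first by lia.
have [[ij0 ik0]|nij0] := EM (i = j0 /\ multiple (c i) (k - k0)).
  by rewrite (height_coset _ ik0) ij0; lia.
by apply: (le_trans (neg i k nij0)); lia.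
Qed.

Lemma dominates_reflection_start j : dominates j 0 (reflection j *m o).
Proof.
case: pp => _ _ _ _ oP.
have hE i k : height i k o = (p i *m o) 0 0.
  by rewrite /height -mulmxA; case: (oP (- k)) => ->.
have neg i : (p i *m o) 0 0 < 0 by case: (oP 0).
apply: dominates_reflection => [|i k _]; rewrite !hE; first by rewrite oppr_gt0.
by move: (neg i) (neg j); lia.
Qed.

Lemma dominates_neq_start j k u : dominates j k u -> u <> o.
Proof.
case=> pos _ uo; move: pos; case: pp => _ _ _ _ /(_ (- k)) [oA /(_ j)].
by rewrite uo /height -mulmxA oA; lia.
Qed.
End Dynamics.
End PingPong.

(** * Words in the HNN extension *)

Section Words.

Lemma weq_hnn_base (S : choiceType) (RK : word S -> Prop) n (w : 'I_n -> word S) u v :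
  weq RK u v -> weq (hnn_relators RK w) (wmap inl u) (wmap inl v).
Proof.
rewrite /wmap; elim=> {u v} [u|u v _|u v z _ IH1 _|u l v|u r v Rr].
- exact: weq_refl.
- exact: weq_sym.
- exact: weq_trans.
- by rewrite !map_cat; apply: (weq_cancel _ _ (inl l.1, l.2)).
- by rewrite !map_cat; apply: weq_relator; apply: hnn_base.
Qed.

Lemma wmap_winv (S S' : Type) (f : S -> S') u : wmap f (winv u) = winv (wmap f u).
Proof. by rewrite /wmap /winv map_rev -!map_comp. Qed.

Section BaseVectors.
Local Open Scope ring_scope.
Variables (S : choiceType) (RK : word S -> Prop) (V : zmodType).
Variable h : presented RK -> V.
Hypothesis hM : {morph h : x y / (x * y)%g >-> x + y}.
Hypothesis h_inj : injective h.

Definition wvec (u : word S) : V := h (pclass RK u).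

Lemma wvec_cat u v : wvec (u ++ v) = wvec u + wvec v.
Proof. by rewrite /wvec -pmulE; apply: hM. Qed.

Lemma wvec_nil : wvec [::] = 0.
Proof. by apply: (addrI (wvec [::])); rewrite -wvec_cat addr0. Qed.

Lemma wvec_weq u v : weq RK u v -> wvec u = wvec v.
Proof. by move/pclassP => uv; rewrite /wvec uv. Qed.

Lemma wvec_inj u v : wvec u = wvec v -> weq RK u v.
Proof. by move/h_inj/pclassP. Qed.

Lemma wvec_winv u : wvec (winv u) = - wvec u.
Proof.
by apply: (addIr (wvec u)); rewrite -wvec_cat (wvec_weq (weq_invl _ u)) wvec_nil addNr.
Qed.

(** If the vector of k is z times that of w_i, then k equals w_i^z in K, so it
   commutes with t_i. *)
Lemma pinch n (w : 'I_n -> word S) i b k :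
  multiple (wvec (w i)) (wvec k) ->
  weq (hnn_relators RK w) ((inr i, b) :: wmap inl k ++ [:: (inr i, ~~ b)]) (wmap inl k).
Proof.
set HR := hnn_relators RK w => -[z kz].
pose G := presented HR.
pose cl : word (S + 'I_n) -> G := pclass HR.
have clM u v : cl (u ++ v) = (cl u * cl v)%g by rewrite /cl -pmulE.
have clV u : cl (winv u) = (cl u)^-1%g by rewrite /cl -pinvE.
have cl1 : cl [::] = 1%g by [].
pose t c : G := cl [:: (inr i, c)].
have tV c : t (~~ c) = (t c)^-1%g by rewrite /t -clV.
pose C u := commute (t b) (cl (wmap inl u)).
have Cw : C (w i).
  have tw : commute (t false) (cl (wmap inl (w i))).
    have : cl (wcomm [:: gen (inr i)] (wmap inl (w i))) = 1%g.
      rewrite -cl1; apply/pclassP; rewrite -[wcomm _ _]cats0.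
      exact: (@weq_relator _ HR [::] _ [::] (hnn_comm _ _ _)).
    rewrite /wcomm !clM !clV -/(t false) => e.
    by rewrite /commute; apply: (mulIg (t false)^-1%g); apply: (mulIg (cl (wmap inl (w i)))^-1%g);
      rewrite -!mulgA e mulVKg mulgV.
  suff tw' d : commute (t d) (cl (wmap inl (w i))) by exact: tw'.
  case: d => //; rewrite -[true]/(~~ false) tV.
  exact/commute_sym/commuteV/commute_sym.
have CD u v : C u -> C v -> C (u ++ v).
  by rewrite /C /wmap map_cat clM; apply: commuteM.
have CV u : C u -> C (winv u) by rewrite /C wmap_winv clV; apply: commuteV.
have [u [Cu uz]] : exists u, C u /\ wvec u = wvec (w i) *~ z.
  have pw m : exists u, C u /\ wvec u = wvec (w i) *+ m.
    elim: m => [|m [u [Cu uE]]].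
      by exists [::]; rewrite wvec_nil mulr0n; split=> //; apply: commute1.
    by exists (w i ++ u); rewrite wvec_cat uE mulrS; split=> //; apply: CD.
  case: z {kz} => m; first exact: pw.
  have [u [Cu uE]] := pw m.+1; exists (winv u).
  by rewrite wvec_winv uE NegzE mulrNz; split=> //; apply: CV.
have ku : cl (wmap inl k) = cl (wmap inl u).
  by apply/pclassP/weq_hnn_base/wvec_inj; rewrite kz uz.
apply/pclassP; rewrite -/(cl _) -cat1s -/(cl (wmap inl k)) !clM ku -!/(t _) tV.
by rewrite mulgA Cu mulgK.
Qed.
End BaseVectors.

Section Representation.
Local Open Scope ring_scope.
Variables (S : choiceType) (RK : word S -> Prop) (n : nat) (w : 'I_n -> word S).
Variables (V : zmodType) (h : presented RK -> V).
Hypothesis hM : {morph h : x y / (x * y)%g >-> x + y}.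
Hypothesis h_inj : injective h.

(** The index None is an additional stable letter with trivial associated
   subgroup.  No letter acts by its reflections; its cosets are the elements of
   K, so its pairings tell them apart. *)
Definition axis (j : option 'I_n * bool) : V :=
  if j.1 is Some i then wvec h (w i) else 0.

Variables (N : nat) (A : V -> 'M[int]_N).
Variables (p : option 'I_n * bool -> 'rV[int]_N) (v : option 'I_n * bool -> 'cV[int]_N).
Variable o : 'cV[int]_N.
Hypothesis pp : ping_pong axis A p v o.

Let R := reflection p v.
Let A0 : A 0 = 1%:M. Proof. by case: pp => [[]]. Qed.
Let AD k l : A (k + l) = A k *m A l. Proof. by case: pp => [[]]. Qed.

Definition lmx (l : letter (S + 'I_n)) : 'M[int]_N :=
  match l with
  | (inl s, b) => A (wvec h [:: (s, b)])
  (* Two reflections, because a single one is an involution.  They are distinct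
     players, so the second can always follow the first; and a power of t_i
     alternates between them. *)
  | (inr i, b) => R (Some i, b) *m R (Some i, ~~ b)
  end.

Definition wmx (u : word (S + 'I_n)) : 'M[int]_N :=
  foldr (fun l M => lmx l *m M) 1%:M u.

Lemma wmx_cat u u' : wmx (u ++ u') = wmx u *m wmx u'.
Proof. by elim: u => [|l u IH] /=; rewrite ?mul1mx // IH mulmxA. Qed.

Lemma wmx_base k : wmx (wmap inl k) = A (wvec h k).
Proof.
elim: k => [|[s b] k IH] /=; first by rewrite wvec_nil.
by rewrite IH -AD -wvec_cat.
Qed.

Lemma lmx_linv l : lmx l *m lmx (linv l) = 1%:M.
Proof.
case: l => [[s|i] b] /=.
  rewrite -AD -wvec_cat // -A0; congr A; rewrite -(wvec_nil hM).
  exact: wvec_weq (weq_cancel _ [::] (s, b) [::]).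
by rewrite negbK mulmxA -(mulmxA (R _)) (reflectionK pp) mulmx1 (reflectionK pp).
Qed.

Lemma wmx_winv u : wmx u *m wmx (winv u) = 1%:M.
Proof.
elim: u => [|l u IH] /=; first by rewrite mulmx1.
rewrite /winv /= rev_cons -cats1 wmx_cat /= mulmx1 -mulmxA (mulmxA (wmx u)).
by rewrite IH mul1mx lmx_linv.
Qed.

Lemma wmx_relator r : hnn_relators RK w r -> wmx r = 1%:M.
Proof.
case=> [{}r Rr|i].
  rewrite wmx_base -A0; congr A; rewrite -(wvec_nil hM).
  by have := weq_relator [::] [::] Rr; rewrite cats0 => /wvec_weq.
rewrite /wcomm !wmx_cat; set T := wmx [:: _]; set W := wmx (wmap _ _).
have WT : T *m W = W *m T.
  have cR b : A (wvec h (w i)) *m R (Some i, b) = R (Some i, b) *m A (wvec h (w i)).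
    exact: reflection_comm pp (Some i, b).
  by rewrite /T /W wmx_base /= mulmx1 -mulmxA -cR mulmxA -cR mulmxA.
by rewrite mulmxA WT -mulmxA (mulmxA T) wmx_winv mul1mx wmx_winv.
Qed.

Lemma wmx_weq u u' : weq (hnn_relators RK w) u u' -> wmx u = wmx u'.
Proof.
elim=> {u u'} [//|u u' _ -> //|u u' z _ -> _ -> //|u l z|u r z Rr].
  by rewrite !wmx_cat /= (mulmxA (lmx l)) lmx_linv mul1mx.
by rewrite !wmx_cat (wmx_relator Rr) mul1mx.
Qed.

Definition stable_letters (u : word (S + 'I_n)) : nat :=
  count (fun l => if l.1 is inr _ then true else false) u.

Lemma stable_letters_base k : stable_letters (wmap inl k) = 0%N.
Proof. by elim: k. Qed.

(** Reading a word from the right, either a pinch appears, or the leftmost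
   stable letter leaves its own player, translated by the letters of K before
   it, dominating the image of o. *)
Lemma normal_form_trichotomy u :
  [\/ exists2 u', weq (hnn_relators RK w) u u' & (stable_letters u' < stable_letters u)%N,
      exists k, u = wmap inl k
    | exists k i b u', u = wmap inl k ++ (inr i, b) :: u' /\
        dominates axis A p (Some i, b) (wvec h k) (wmx u *m o)].
Proof.
have letter i b z :
    dominates axis A p (Some i, ~~ b) 0 (R (Some i, ~~ b) *m z) ->
    dominates axis A p (Some i, b) 0 (lmx (inr i, b) *m z).
  move=> d; rewrite /= -mulmxA; apply: (dominates_reflection_next pp d).
  by case=> [] [] /eqP; rewrite eq_sym; case: b {d}.
elim: u => [|[[s|j] b'] u IH]; first by constructor 2; exists [::].
  case: IH => [[u' uu' lt]|[k ->]|[k [i [b [u' [uE d]]]]]].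
  - constructor 1; exists ((inl s, b') :: u') => //=.
    by have := weq_ctx [:: (inl s, b')] [::] uu'; rewrite !cats0.
  - by constructor 2; exists ((s, b') :: k).
  - constructor 3; exists ((s, b') :: k), i, b, u'; split; first by rewrite uE.
    rewrite -cat1s wvec_cat // addrC /= -mulmxA.
    exact: (dominates_shift pp).
case: IH => [[u' uu' lt]|[k ->]|[k [i [b [u' [uE d]]]]]].
- constructor 1; exists ((inr j, b') :: u') => //=.
  by have := weq_ctx [:: (inr j, b')] [::] uu'; rewrite !cats0.
- constructor 3; exists [::], j, b', (wmap inl k); split=> //.
  rewrite wvec_nil // [wmx _]/= wmx_base -mulmxA.
  have -> : A (wvec h k) *m o = o by case: pp => _ _ _ _ /(_ (wvec h k)) [].
  exact/letter/(dominates_reflection_start pp).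
(* The first reflection of the letter (j, b') is in the player
   (Some j, ~~ b'); this player already dominates precisely when the two stable
   letters cancel across k. *)
- have [[[ij bb'] kw]|np] :=
      EM ((Some j, ~~ b') = (Some i, b) /\ multiple (wvec h (w j)) (wvec h k)).
    constructor 1; exists (wmap inl k ++ u').
      have := weq_ctx [::] u' (pinch hM h_inj b' kw).
      by rewrite uE -bb' -ij /= -catA.
    by rewrite uE /stable_letters /= !count_cat /=; lia.
  constructor 3; exists [::], j, b', u; split=> //.
  rewrite wvec_nil // [wmx _]/= -mulmxA.
  exact/letter/(dominates_reflection_next pp d).
Qed.

Lemma wmx_inj u : wmx u = 1%:M -> weq (hnn_relators RK w) u [::].
Proof.
have [m] := ubnP (stable_letters u); elim: m u => // m IH u /ltnSE le u1.
case: (normal_form_trichotomy u) => [[u' uu' lt]|[k uE]|[k [i [b [u' [_ d]]]]]].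
- apply: (weq_trans uu'); apply: IH; first exact: leq_trans lt le.
  by rewrite -(wmx_weq uu').
- rewrite uE; apply: (@weq_hnn_base _ _ _ _ k [::]); apply: (wvec_inj h_inj).
  rewrite wvec_nil //; move: u1; rewrite uE wmx_base => Ak.
  have [[z ->]|nk] := EM (multiple 0 (wvec h k)); first by rewrite mul0rz.
  have [_ _ p2 le2 _] := pp.
  have := le2 (None, true) (None, true) (wvec h k).
  by rewrite Ak mulmx1 p2 => /(_ (fun e => nk e.2)).
- by case: (dominates_neq_start pp d); rewrite u1 mul1mx.
Qed.

Lemma hnn_Z_linear : Z_linear (presented (hnn_relators RK w)).
Proof.
have unit u : wmx u \in unitmx by case: (mulmx1_unit (wmx_winv u)).
exists N, (fun x => MkGLmx (unit (repr x))); split.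
  move=> x y; apply: val_inj => /=; rewrite -wmx_cat; apply: wmx_weq.
  exact: weq_repr.
move=> x y /(congr1 val) /= xy.
rewrite -(pclass_repr x) -(pclass_repr y); apply/pclassP.
set u := repr x in xy *; set u' := repr y in xy *.
have : weq (hnn_relators RK w) (winv u' ++ u) [::].
  by apply: wmx_inj; rewrite wmx_cat xy -wmx_cat (wmx_weq (weq_invl _ u')).
move=> /(weq_cat (weq_refl _ u')); rewrite cats0 catA => e.
apply: weq_trans e; apply: weq_sym.
exact: (weq_cat (weq_invr _ u') (weq_refl _ u)).
Qed.
End Representation.
End Words.

Theorem theorem4p2 (S : choiceType) (RK : word S -> Prop) (n : nat)
    (w : 'I_n -> word S) :
  fg_free_abelian (presented RK) ->
  0 < n ->
  Z_linear (presented (hnn_relators RK w)).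
Proof.
move=> [r [h [hM h_bij]]] _.
have [N [A [p [v [o pp]]]]] := ping_pong_exists (axis w h).
exact: (hnn_Z_linear hM (bij_inj h_bij) pp).
Qed.
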